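(* There exist absolute constants $C,c\in(0,\infty)$ such that the following holds for every positive integer $n$. Let $p(x)=\sum_{\alpha\in\{0,1,2,3\}^n,\,|\alpha|=3}c_\alpha x^\alpha$ be a random cubic form in $n$ variables whose coefficients $c_\alpha$ are independent random variables, each uniformly distributed on $\{-1,1\}$. Then with probability at least $1-Cne^{-cn}$ we have $\|p\|_{\mathrm{cb}}\ge c\sqrt n\,\|p\|$.
   Context: $|\alpha|=\sum_i\alpha_i$ and $x^\alpha=\prod_ix_i^{\alpha_i}$. $\|p\|=\sup\{|p(x)|:x\in\{-1,1\}^n\}$. For a real form $p(x)=\sum_{|\alpha|=s}c_\alpha x^\alpha$ of degree $s$ in $N$ variables, $T_p\in\mathbb{R}^{N\times\cdots\times N}$ is the symmetric tensor $(T_p)_{i_1,\dots,i_s}=c_{e_{i_1}+\dots+e_{i_s}}/\tau(i_1,\dots,i_s)$, $\tau$ being the number of distinct permutations of $(i_1,\dots,i_s)$. For an $s$-tensor $T$, $\|T\|_{\mathrm{cb}}=\sup\|\sum_{i_1,\dots,i_s}T_{i_1,\dots,i_s}U_1(i_1)\cdots U_s(i_s)\|$ over all $k$ and $k\times k$ unitaries $U_j(i)$ (operator norm). With $(T\circ\sigma)_{i_1,\dots,i_s}=T_{i_{\sigma(1)},\dots,i_{\sigma(s)}}$, $\|p\|_{\mathrm{cb}}=\inf\{\sum_{\sigma\in S_s}\|T^\sigma\|_{\mathrm{cb}}:T_p=\sum_{\sigma\in S_s}T^\sigma\circ\sigma\}$. *)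

(* Defs.v *)
From HB Require Import structures.
From mathcomp Require Import all_boot all_order all_algebra.
From mathcomp Require Import all_classical all_reals all_analysis.
From mathcomp Require Import fingroup perm complex.
Import ComplexField.
Set Implicit Arguments. Unset Strict Implicit. Unset Printing Implicit Defensive.
Import Order.TTheory GRing.Theory Num.Theory.
Local Open Scope ring_scope.

Section Defs.
Variable R : realType.

Definition cvnorm k (v : 'cV[R[i]]_k) : R :=
  Num.sqrt (\sum_(j < k) ((complex.Re (v j 0)) ^+ 2 + (complex.Im (v j 0)) ^+ 2)).

Definition opnorm k (A : 'M[R[i]]_k) : \bar R :=
  ereal_sup [set ((cvnorm (A *m v))%:E) | v in [set v : 'cV[R[i]]_k | cvnorm v = 1]].

Definition adjmx k (U : 'M[R[i]]_k) : 'M[R[i]]_k := (map_mx (@conjc R) U)^T.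
Definition unitary k (U : 'M[R[i]]_k) : Prop := U *m adjmx U = 1%:M.

Definition tensor (N s : nat) := {ffun 'I_s -> 'I_N } -> R.

Definition tcomp N s (T : tensor N s) (sigma : {perm 'I_s}) : tensor N s :=
  fun i => T [ffun t => i (sigma t)].

(* sum_{i_1..i_s} T_{i_1..i_s} U_1(i_1) ... U_s(i_s), for k x k matrices
   (k = k'.+1 so that square matrices form a ring). *)
Definition tensor_eval N s (T : tensor N s) k'
  (U : 'I_s -> 'I_N -> 'M[R[i]]_k'.+1) : 'M[R[i]]_k'.+1 :=
  \sum_(i : {ffun 'I_s -> 'I_N }) (real_complex R (T i) *: \prod_(j < s) U j (i j)).

Definition tensor_cbnorm N s (T : tensor N s) : \bar R :=
  ereal_sup [set x | exists k' : nat, exists U : 'I_s -> 'I_N -> 'M[R[i]]_k'.+1,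
     (forall j a, unitary (U j a)) /\ x = opnorm (tensor_eval T U)].

(* A real form of degree s in N variables is given by its coefficient
   function alpha |-> c_alpha on exponent vectors alpha : {ffun 'I_N -> nat}
   (c_alpha = 0 unless |alpha| = s). *)

Definition multidx N s (i : {ffun 'I_s -> 'I_N }) : {ffun 'I_N -> nat} :=
  [ffun a => #|[set t | i t == a]|].

Definition tau N s (i : {ffun 'I_s -> 'I_N }) : nat :=
  #|[set [ffun t => i (sigma t)] | sigma : {perm 'I_s}]|.

Definition form_tensor N s (coef : {ffun 'I_N -> nat} -> R) : tensor N s :=
  fun i => coef (multidx i) / (tau i)%:R.

Definition form_cbnorm N s (coef : {ffun 'I_N -> nat} -> R) : \bar R :=
  ereal_inf [set x | exists Ts : {perm 'I_s} -> tensor N s,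
     (forall i, @form_tensor N s coef i = \sum_(sigma : {perm 'I_s}) tcomp (Ts sigma) sigma i)
     /\ x = (\sum_(sigma : {perm 'I_s}) tensor_cbnorm (Ts sigma))%E].

Definition mon3 (n : nat) := {a : {ffun 'I_n -> 'I_4} | \sum_(j < n) (a j : nat) == 3%N}.

Definition mon3_nat n (a : mon3 n) : {ffun 'I_n -> nat} := [ffun j => (sval a j : nat)].

Definition sgn (b : bool) : R := if b then 1 else -1.

Definition cubic_coef n (eps : {ffun mon3 n -> bool}) (b : {ffun 'I_n -> nat}) : R :=
  if [pick a : mon3 n | mon3_nat a == b] is Some a then sgn (eps a) else 0.

Definition cubic_eval n (eps : {ffun mon3 n -> bool}) (x : 'I_n -> R) : R :=
  \sum_(a : mon3 n) sgn (eps a) * \prod_(j < n) x j ^+ (sval a j).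

Definition cube_supnorm n (eps : {ffun mon3 n -> bool}) : R :=
  \big[Num.max/0]_(x : {ffun 'I_n -> bool}) `|cubic_eval eps (fun j => sgn (x j))|.

End Defs.

(* Main.v *)
Require Import Defs.
From HB Require Import structures.
From mathcomp Require Import all_boot all_order all_algebra.
From mathcomp Require Import all_classical all_reals all_analysis.
From mathcomp Require Import fingroup perm complex ring lra zify.
Import ComplexField.
Import Order.TTheory GRing.Theory Num.Theory.
Local Open Scope ring_scope.

(* Pair [T_p] with the symmetric tensor [S = T_p / (120 sqrt n)].  If the slices
   [W_j = S(., j, .)] are contractions, each is the average of a unitary and its
   adjoint, so that for every tensor [T] the number [sum T S] is an average of values
   of the form [Re <e_0, sum T_ijk U_0(i) U_1(j) U_2(k) e_0>] and is at most
   [|T|_cb].  As [S] is symmetric, summing over a decomposition of [T_p] gives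
   [|p|_cb >= sum T_p S >= n^3 / (36 * 120 sqrt n)], since every entry of [T_p] is
   at least 1/6 in absolute value.  The slices have operator norm at most
   [120 sqrt n] with high probability (subgaussian tails and a union bound over a
   net of the unit ball), and [|p| <= 4 n^2] by a union bound over the cube. *)

(** * Subgaussian tails of Rademacher sums under the uniform probability *)

Lemma sgn_sqr (R : realType) (b : bool) : sgn R b ^+ 2 = 1.
Proof. by case: b; rewrite /= ?sqrrN expr1n. Qed.

(** The sharp exponent is [x ^+ 2 / 2]; the weaker constant 2 allows an elementary proof. If
    [|x| >= 1/2] then [|x| <= 2 x^2], which bounds both exponentials. Otherwise
    [expR y <= 1 / (1 - y)] bounds the sum by [2 / (1 - x^2)], which is at most [2 (1 + 2 x^2)]. *)
Lemma cosh_le_expR (R : realType) (x : R) :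
  expR x + expR (- x) <= 2 * expR (2 * x ^+ 2).
Proof.
have x2 : `|x| ^+ 2 = x ^+ 2 by rewrite real_normK // num_real.
case: (lerP (1 / 2) `|x|) => [xl|xs].
  have h (y : R) : `|y| = `|x| -> expR y <= expR (2 * x ^+ 2).
    move=> yx; rewrite ler_expR (le_trans (ler_norm y))// yx -x2 expr2 mulrA ler_peMl//; lra.
  by move: (h x erefl) (h (- x) (normrN _)) => *; lra.
have hu (y : R) : expR y * (1 - y) <= 1.
  have := expR_ge1Dx (- y); have := expR_gt0 y; rewrite expRN => h1 h2.
  by rewrite mulrC -ler_pdivlMr// div1r.
have := hu x; have := hu (- x); rewrite opprK.
have := expR_ge1Dx (2 * x ^+ 2).
have : - (1 / 2) < x < 1 / 2 by rewrite -ltr_norml.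
move=> /andP[? ?]; set u := expR x; set v := expR (- x).
move=> h1 h2 h3; apply: le_trans (_ : 2 * (1 + 2 * x ^+ 2) <= _); last lra.
have h4 : (u + v) * ((1 - x) * (1 + x)) <= 2 by nra.
have h5 : 0 < (1 - x) * (1 + x) by nra.
have h6 : 2 <= 2 * (1 + 2 * x ^+ 2) * ((1 - x) * (1 + x)).
  have : 0 <= x ^+ 2 * (1 - 2 * x ^+ 2) by apply: mulr_ge0; nra.
  lra.
by rewrite -(ler_pM2r h5) (le_trans h4).
Qed.

Definition uprob (R : realType) (T : finType) (E : {set T}) : R :=
  #|E|%:R / #|T|%:R.

Lemma uprob_sub (R : realType) (T : finType) (E F : {set T}) :
  E \subset F -> uprob R T E <= uprob R T F.
Proof. by move=> EF; rewrite ler_wpM2r ?invr_ge0 ?ler0n// ler_nat subset_leq_card. Qed.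

Lemma uprobU (R : realType) (T : finType) (E F : {set T}) :
  uprob R T (E :|: F) <= uprob R T E + uprob R T F.
Proof.
by rewrite -mulrDl ler_wpM2r ?invr_ge0 ?ler0n// -natrD ler_nat leq_card_setU.
Qed.

Lemma uprob_bigcup (R : realType) (T I : finType) (P : pred I) (E : I -> {set T}) (b : R) :
  (forall i, P i -> uprob R T (E i) <= b) ->
  uprob R T (\bigcup_(i | P i) E i) <= #|P|%:R * b.
Proof.
move=> Eb; apply: (le_trans (y := \sum_(i | P i) uprob R T (E i))).
  elim/big_ind2: _ => [|A a B c Aa Bc|//]; first by rewrite /uprob cards0 mul0r.
  by apply: le_trans (uprobU _ _ _ _) (lerD _ _).
by apply: le_trans (ler_sum _ Eb) _; rewrite sumr_const mulr_natl.
Qed.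

Lemma uprobC (R : realType) (T : finType) (E : {set T}) :
  (0 < #|T|)%N -> uprob R T (~: E) = 1 - uprob R T E.
Proof.
move=> T0; apply/eqP; rewrite eq_sym subr_eq addrC -mulrDl -natrD cardsC divff//.
by rewrite pnatr_eq0 -lt0n.
Qed.

Section Rademacher.
Context (R : realType) (A : finType).
Implicit Types (eps : {ffun A -> bool}) (c : A -> R).

(** Independence of the signs is distributivity: the sum over all sign patterns is a product over
    [a] of two-term sums, each bounded by [cosh_le_expR]. The sum is not normalised, hence the
    factor [2 ^+ #|A|]. *)
Lemma rademacher_mgf c (l : R) :
  \sum_(eps : {ffun A -> bool}) expR (l * \sum_a sgn R (eps a) * c a)
    <= 2 ^+ #|A| * expR (2 * l ^+ 2 * \sum_a c a ^+ 2).
Proof.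
pose F a b := expR (l * (sgn R b * c a)).
have -> : \sum_(eps : {ffun A -> bool}) expR (l * \sum_a sgn R (eps a) * c a)
    = \prod_a \sum_b F a b.
  rewrite bigA_distr_bigA; apply: eq_bigr => eps _.
  by rewrite mulr_sumr expR_sum.
rewrite mulr_sumr expR_sum -prodr_const -big_split/=; apply: ler_prod => a _.
rewrite big_bool /F /sgn mul1r mulN1r mulrN addr_ge0 ?expR_ge0//=.
by have := cosh_le_expR R (l * c a); rewrite exprMn mulrA.
Qed.

Lemma rademacher_upper_tail c (s t : R) : 0 < s -> 0 <= t -> \sum_a c a ^+ 2 <= s ->
  uprob R _ [set eps : {ffun A -> bool} | t < \sum_a sgn R (eps a) * c a]
    <= expR (- (t ^+ 2 / (8 * s))).
Proof.
(* Chernoff's method: this [l] minimises [2 l^2 s - l t], and the minimum is [- t^2 / (8 s)]. *)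
move=> s0 t0 cs; set E := [set _ | _]; pose l := t / (4 * s).
have l0 : 0 <= l by rewrite divr_ge0// mulr_ge0// ltW.
have : #|E|%:R * expR (l * t) <= 2 ^+ #|A| * expR (2 * l ^+ 2 * s).
  apply: (le_trans (y := \sum_(eps : {ffun A -> bool}) expR (l * \sum_a sgn R (eps a) * c a))).
    rewrite mulr_natl -sumr_const [leRHS](bigID (mem E))/= -[leLHS]addr0.
    apply: lerD; last by apply: sumr_ge0 => *; exact: expR_ge0.
    apply: ler_sum => eps; rewrite inE => /ltW te.
    by rewrite ler_expR ler_wpM2l.
  apply: le_trans (rademacher_mgf c l) _; rewrite ler_wpM2l ?exprn_ge0//.
  by rewrite ler_expR ler_wpM2l// mulr_ge0// sqr_ge0.
have e0 := expR_gt0 (l * t); have c0 : 0 < (2 : R) ^+ #|A| by rewrite exprn_gt0.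
move=> h; rewrite /uprob card_ffun card_bool natrX ler_pdivrMr// -(ler_pM2r e0).
apply: le_trans h _; rewrite [leLHS]mulrC [leRHS]mulrAC -expRD ler_pM2r// ler_expR.
rewrite le_eqVlt; apply/orP; left; apply/eqP; rewrite /l; field; exact: lt0r_neq0.
Qed.

Lemma rademacher_tail c (s t : R) : 0 < s -> 0 <= t -> \sum_a c a ^+ 2 <= s ->
  uprob R _ [set eps : {ffun A -> bool} | t < `|\sum_a sgn R (eps a) * c a|]
    <= 2 * expR (- (t ^+ 2 / (8 * s))).
Proof.
move=> s0 t0 cs; rewrite mulrDl mul1r.
have cs' : \sum_a (- c a) ^+ 2 <= s by under eq_bigr do rewrite sqrrN.
apply: le_trans (lerD (rademacher_upper_tail _ _ _ s0 t0 cs)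
                      (rademacher_upper_tail _ _ _ s0 t0 cs')).
apply: le_trans (uprobU _ _ _ _); apply: uprob_sub; apply/fintype.subsetP => eps.
rewrite !inE lter_normr => /orP[->//|te]; apply/orP; right.
by under eq_bigr do rewrite mulrN; rewrite sumrN.
Qed.

End Rademacher.

(** * Quadratic forms on a net of the unit ball *)

Section GridNet.
Context (R : realType) (n : nat).
Implicit Types (x y r : 'I_n -> R) (M : 'M[R]_n).

Definition sqn x : R := \sum_k x k ^+ 2.
Definition bil M x y : R := \sum_k \sum_l x k * M k l * y l.

Lemma sqn_ge0 x : 0 <= sqn x.
Proof. by apply: sumr_ge0 => k _; exact: sqr_ge0. Qed.

Lemma sqn_coord_le1 x k : sqn x <= 1 -> `|x k| <= 1.
Proof.
move=> x1; rewrite -(@expr_le1 _ 2)// real_normK ?num_real//.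
apply: le_trans x1; rewrite /sqn (bigD1 k)//= lerDl.
by apply: sumr_ge0 => l _; exact: sqr_ge0.
Qed.

Lemma bilDl M x r y : bil M (fun k => x k + r k) y = bil M x y + bil M r y.
Proof.
rewrite /bil -big_split; apply: eq_bigr => k _ /=.
by rewrite -big_split; apply: eq_bigr => l _ /=; ring.
Qed.

Lemma bilDr M x y r : bil M x (fun k => y k + r k) = bil M x y + bil M x r.
Proof.
rewrite /bil -big_split; apply: eq_bigr => k _ /=.
by rewrite -big_split; apply: eq_bigr => l _ /=; ring.
Qed.

Lemma bilZl M a x y : bil M (fun k => a * x k) y = a * bil M x y.
Proof.
rewrite /bil mulr_sumr; apply: eq_bigr => k _ /=.
by rewrite mulr_sumr; apply: eq_bigr => l _ /=; ring.
Qed.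

Lemma bilZr M a x y : bil M x (fun k => a * y k) = a * bil M x y.
Proof.
rewrite /bil mulr_sumr; apply: eq_bigr => k _ /=.
by rewrite mulr_sumr; apply: eq_bigr => l _ /=; ring.
Qed.

Lemma sqnZ a x : sqn (fun k => a * x k) = a ^+ 2 * sqn x.
Proof. by rewrite /sqn mulr_sumr; apply: eq_bigr => k _; rewrite exprMn. Qed.

(* Coordinates are integers of size at most [4 n], kept as sign and magnitude; the
   net consists of the grid vectors divided by [4 sqrt n]. *)
Definition grid := {ffun 'I_n -> bool * 'I_(4 * n).+1}.
Definition gridv (g : grid) : 'I_n -> R :=
  fun k => sgn R (g k).1 * (g k).2%:R / (4 * Num.sqrt n%:R).
Definition net (g : grid) : bool := (\sum_k (g k).2 ^ 2 <= 16 * n)%N.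

Hypothesis n_gt0 : (0 < n)%N.
Let sqrtn_gt0 : 0 < Num.sqrt n%:R :> R.
Proof. by rewrite sqrtr_gt0 ltr0n. Qed.
Let sqrtn2 : Num.sqrt n%:R ^+ 2 = n%:R :> R.
Proof. by rewrite sqr_sqrtr. Qed.

Lemma net_sqn_le1 g : net g -> sqn (gridv g) <= 1.
Proof.
rewrite /net -(ler_nat R) natr_sum natrM => gn.
have -> : sqn (gridv g) = (\sum_k ((g k).2 ^ 2)%:R) / (16 * n%:R).
  rewrite /sqn mulr_suml; apply: eq_bigr => k _; rewrite /gridv.
  rewrite !exprMn sgn_sqr mul1r exprVn exprMn sqrtn2 natrX.
  by congr (_ / (_ * _)); rewrite -natrX.
by rewrite ler_pdivrMr ?mul1r// mulr_gt0// ltr0n.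
Qed.

(** Each coordinate of [4 sqrt n x] is truncated towards zero. Magnitudes do not grow, so the grid
    point satisfies the net condition; each coordinate moves by at most [1 / (4 sqrt n)], and [n]
    squares of this size sum to 1/16. *)
Lemma net_round x : sqn x <= 1 ->
  exists g, net g /\ sqn (fun k => x k - gridv g k) <= 1 / 16.
Proof.
move=> x1; set q : R := 4 * Num.sqrt n%:R.
have q0 : 0 < q by rewrite mulr_gt0.
have q2 : q ^+ 2 = 16 * n%:R by rewrite exprMn sqrtn2; congr (_ * _); rewrite -natrX.
have t0 k : 0 <= q * `|x k| by rewrite mulr_ge0// ltW.
pose z k := Num.truncn (q * `|x k|).
have zb k : (z k)%:R <= q * `|x k| < (z k).+1%:R by exact: truncn_itv.
(* The magnitude fits its ordinal type because [|x k| <= 1] and [sqrt n <= n]. *)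
have z4 k : (z k <= 4 * n)%N.
  have /andP[zk _] := zb k.
  rewrite -(ler_nat R) (le_trans zk)//.
  apply: (le_trans (y := q * 1)); first by rewrite ler_wpM2l ?(ltW q0)// sqn_coord_le1.
  rewrite mulr1 natrM ler_wpM2l// -[leRHS]sqrtn2 expr2 ler_peMl ?(ltW sqrtn_gt0)//.
  by rewrite -[leLHS]sqrtr1 ler_wsqrtr// ler1n.
pose g : grid := [ffun k => (0 <= x k, inord (z k))].
have gE k : (g k).2 = z k :> nat by rewrite ffunE/= inordK// ltnS.
exists g; split.
  rewrite /net; under eq_bigr do rewrite gE.
  rewrite -(ler_nat R) natr_sum natrM -q2 -[leRHS]mulr1.
  apply: le_trans (_ : q ^+ 2 * sqn x <= _); last by rewrite ler_wpM2l// sqr_ge0.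
  rewrite /sqn mulr_sumr; apply: ler_sum => k _.
  rewrite natrX -[x k ^+ 2]real_normK ?num_real// -exprMn lerXn2r// ?nnegrE//.
  by have /andP[] := zb k.
apply: (le_trans (y := \sum_(k < n) (q^-1) ^+ 2)); last first.
  rewrite sumr_const card_ord exprVn q2 -[_ *+ n]mulr_natr.
  rewrite le_eqVlt; apply/orP; left; apply/eqP; field.
  by rewrite pnatr_eq0 -lt0n.
apply: ler_sum => k _; rewrite -real_normK ?num_real// lerXn2r// ?nnegrE ?invr_ge0 ?(ltW q0)//.
have -> : `|x k - gridv g k| = `| `|x k| - (z k)%:R / q |.
  rewrite /gridv gE ffunE/=; case: (lerP 0 (x k)) => xk /=.
    by rewrite mul1r (ger0_norm xk).
  by rewrite (ltr0_norm xk) mulN1r mulNr opprK -opprD normrN.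
have /andP[zl zu] := zb k.
rewrite ger0_norm; last by rewrite subr_ge0 ler_pdivrMr// mulrC.
rewrite -(ler_pM2l q0) divff ?lt0r_neq0// mulrBr mulrCA divff ?lt0r_neq0// mulr1.
by rewrite lerBlDr addrC natr1 ltW.
Qed.

(** Let [s] be the supremum of the bilinear form over pairs in the unit ball. Rounding both
    arguments leaves two error terms; four times a rounding error is again in the ball, so each term
    costs at most [s / 4]. Hence [s <= m + s / 2], that is [s <= 2 m]. *)
Lemma bil_le_of_net M (m : R) :
  (forall g h, net g -> net h -> `|bil M (gridv g) (gridv h)| <= m) ->
  forall x, `|bil M x x| <= 2 * m * sqn x.
Proof.
move=> gm.
pose E : set R := [set b | exists x y, [/\ sqn x <= 1, sqn y <= 1 & b = `|bil M x y|]]%classic.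
(* A crude entrywise bound makes the supremum finite, which the absorption of [s / 2] requires. *)
have Eub : ubound E (\sum_k \sum_l `|M k l|).
  move=> _ [x [y [x1 y1 ->]]]; apply: le_trans (ler_norm_sum _ _ _) _.
  apply: ler_sum => k _; apply: le_trans (ler_norm_sum _ _ _) _.
  apply: ler_sum => l _; rewrite !normrM -mulrA mulrCA -[leRHS]mulr1.
  by rewrite ler_wpM2l// mulr_ile1// sqn_coord_le1.
have sqn0 : sqn (fun=> 0) = 0 by rewrite /sqn big1// => k _; rewrite expr0n.
have Esup : has_sup E.
  split; last by exists (\sum_k \sum_l `|M k l|).
  exists `|bil M (fun=> 0) (fun=> 0)|, (fun=> 0), (fun=> 0).
  by rewrite sqn0 ler01.
pose s := sup E.
have leS x y : sqn x <= 1 -> sqn y <= 1 -> `|bil M x y| <= s.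
  by move=> x1 y1; apply: ub_le_sup; [case: Esup|exists x, y].
have small r : sqn r <= 1 / 16 -> sqn (fun k => 4 * r k) <= 1.
  by rewrite sqnZ => r16; lra.
have s2m : s <= 2 * m.
  suff : s <= m + s / 2 by lra.
  apply: sup_le_ub; first by case: Esup.
  move=> _ [x [y [x1 y1 ->]]].
  have [g [gn gx]] := net_round _ x1; have [h [hn hy]] := net_round _ y1.
  have -> : bil M x y = bil M (gridv g) (gridv h)
     + bil M (fun k => x k - gridv g k) (gridv h)
     + bil M x (fun k => y k - gridv h k).
    have gK u v : (fun k => gridv u k + (v k - gridv u k)) = v.
      by apply/funext => k; rewrite addrC subrK.
    by rewrite -bilDl gK -bilDr gK.
  have h1 := gm _ _ gn hn.
  have h2 := leS _ _ (small _ gx) (net_sqn_le1 _ hn).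
  have h3 := leS _ _ x1 (small _ hy).
  rewrite bilZl normrM ger0_norm// in h2; rewrite bilZr normrM ger0_norm// in h3.
  apply: le_trans (ler_normD _ _) _.
  by apply: le_trans (lerD (ler_normD _ _) (lexx _)) _; lra.
(* Homogeneity carries the bound from the ball to all [x]; the zero vector cannot be normalised and
   is treated apart. *)
move=> x; have [x0|x0] := eqVneq (sqn x) 0.
  have xk k : x k = 0.
    apply/eqP; rewrite -sqrf_eq0; apply/eqP/le_anti; rewrite sqr_ge0 andbT -x0.
    by rewrite /sqn (bigD1 k)//= lerDl sumr_ge0// => l _; exact: sqr_ge0.
  by rewrite x0 mulr0 /bil big1 ?normr0// => k _; rewrite big1// => l _; rewrite xk !mul0r.
have xp : 0 < sqn x by rewrite lt_neqAle eq_sym x0 sqn_ge0.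
pose a := (Num.sqrt (sqn x))^-1.
have a2 : a ^+ 2 = (sqn x)^-1 by rewrite exprVn sqr_sqrtr ?ltW.
have ax : sqn (fun k => a * x k) <= 1 by rewrite sqnZ a2 mulVf.
have := leS _ _ ax ax; rewrite bilZl bilZr mulrA -expr2 a2 normrM.
rewrite gtr0_norm ?invr_gt0// mulrC ler_pdivrMr// => /le_trans; apply.
by rewrite ler_wpM2r// (ltW xp).
Qed.

Lemma sum_half_pow m : \sum_(i < m) (1 / 2 : R) ^+ i <= 2.
Proof.
suff -> : \sum_(i < m) (1 / 2 : R) ^+ i = 2 - 2 * (1 / 2) ^+ m.
  by rewrite gerBl mulr_ge0// exprn_ge0.
elim: m => [|m IH]; first by rewrite big_ord0 expr0; ring.
by rewrite big_ord_recr/= IH exprS; field.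
Qed.

(** Weight a grid point by 2 to the minus the sum of its magnitudes. On the net this sum is at most
    the sum of squares, hence at most [16 n], so [2 ^+ (16 n)] times the weight is at least 1. The
    total weight factors over coordinates, each contributing at most [2 * 2], the two signs times a
    geometric series. *)
Lemma card_net : #|net|%:R <= (2 : R) ^+ (18 * n).
Proof.
pose w (c : bool * 'I_(4 * n).+1) : R := (1 / 2) ^+ c.2.
have w0 c : 0 <= w c by rewrite exprn_ge0.
apply: (le_trans (y := 2 ^+ (16 * n) * \sum_(g : grid) \prod_k w (g k))).
  rewrite -sum1_card natr_sum mulr_sumr [leRHS](bigID net)/= -[leLHS]addr0.
  apply: lerD; last by apply: sumr_ge0 => g _; rewrite mulr_ge0 ?exprn_ge0// prodr_ge0.
  apply: ler_sum => g gn.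
  rewrite /w -expr_sum div1r exprVn ler_pdivlMr ?exprn_gt0// mul1r ler_weXn2l ?ler1n//.
  apply: leq_trans gn; apply: leq_sum => k _.
  by case: (nat_of_ord (g k).2) => // z; rewrite -mulnn leq_pmulr.
rewrite -(bigA_distr_bigA (fun (_ : 'I_n) c => w c))/= prodr_const card_ord.
have -> : (18 * n = 16 * n + 2 * n)%N by rewrite -mulnDl.
rewrite exprD ler_wpM2l ?exprn_ge0// exprM lerXn2r// ?nnegrE ?sumr_ge0//.
rewrite -(pair_bigA _ (fun (_ : bool) (i : 'I_(4 * n).+1) => (1 / 2 : R) ^+ i))/=.
rewrite big_bool/=; have := sum_half_pow (4 * n).+1; lra.
Qed.

End GridNet.

(** * Lower bounds on completely bounded norms *)

Section CbLowerBound.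
Context (R : realType).
Local Notation C := (R[i]).

Lemma adjmxE k (U : 'M[C]_k) : adjmx U = (map_mx Num.conj U^T)%sesqui.
Proof. by apply/matrixP => i j; rewrite !mxE. Qed.

Lemma adjmxM k (A B : 'M[C]_k) : adjmx (A *m B) = adjmx B *m adjmx A.
Proof. by rewrite /adjmx map_mxM trmx_mul. Qed.

Lemma adjmxK k (A : 'M[C]_k) : adjmx (adjmx A) = A.
Proof. by apply/matrixP => i j; rewrite !mxE conjcK. Qed.

Lemma adjmx_diag k (d : 'rV[C]_k) :
  adjmx (diag_mx d) = diag_mx (map_mx (@conjc R) d).
Proof. by rewrite /adjmx map_diag_mx tr_diag_mx. Qed.

(* In an eigenbasis [W = diag d] with [|d_i| <= 1]; take
   [V = diag (d_i + i sqrt (1 - d_i^2))]. *)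
Lemma real_contraction_unitary_average n (W : 'M[R]_n) :
  W^T = W ->
  (forall x : 'I_n -> R, `|\sum_k \sum_l x k * W k l * x l| <= \sum_k x k ^+ 2) ->
  exists V : 'M[C]_n, [/\ unitary V, unitary (adjmx V) &
    forall k l, complex.Re (V k l) + complex.Re (adjmx V k l) = 2 * W k l].
Proof.
move=> Wsym Wcontr; pose A := map_mx (real_complex R) W.
have Aherm : A \is hermsymmx.
  apply/is_hermitianmxP; rewrite expr0 scale1r; apply/matrixP => i j.
  by rewrite !mxE -{1}Wsym mxE; symmetry; apply: conjc_real.
pose P := spectralmx A; pose sp := spectral_diag A.
have PU : P *m adjmx P = 1%:M.
  by rewrite adjmxE; apply/unitarymxP/spectral_unitarymx.
have UP : adjmx P *m P = 1%:M by exact: mulmx1C PU.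
have AE : A = adjmx P *m diag_mx sp *m P.
  have <- : invmx P = adjmx P.
    by rewrite adjmxE; apply: invmx_unitary; exact: spectral_unitarymx.
  by apply/orthomx_spectralP; exact: hermitian_normalmx Aherm.
pose d i := complex.Re (sp 0 i).
have spE i : sp 0 i = real_complex R (d i).
  by rewrite RRe_real//; have /mxOverP := hermitian_spectral_diag_real Aherm; exact.
(* The eigenvalue is the Hermitian form of [A] at row [i] of [P]. As [W] is real symmetric, it
   splits into the form of [W] at the real and at the imaginary part of that row, whose squared
   norms add up to 1. *)
have d1 i : `|d i| <= 1.
  have : sp 0 i = (P *m A *m adjmx P) i i.
    by rewrite AE -!mulmxA PU mulmx1 mulmxA PU mul1mx mxE eqxx.
  move=> /(congr1 (@complex.Re R)); rewrite -/(d i) => ->.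
  pose a k := complex.Re (P i k); pose b k := complex.Im (P i k).
  have nP : \sum_k a k ^+ 2 + \sum_k b k ^+ 2 = 1.
    rewrite -big_split/=; have /matrixP/(_ i i)/(congr1 (@complex.Re R)) := PU.
    rewrite !mxE eqxx mulr1n /= raddf_sum/= => <-.
    by apply: eq_bigr => k _; rewrite !mxE /a /b; case: (P i k) => ? ?/=; ring.
  have -> : complex.Re ((P *m A *m adjmx P) i i) =
    \sum_k \sum_l a k * W k l * a l + \sum_k \sum_l b k * W k l * b l.
    rewrite -big_split/= mxE raddf_sum/=.
    under [RHS]eq_bigr do rewrite -big_split/=.
    rewrite exchange_big/=; apply: eq_bigr => l _.
    rewrite !mxE mulr_suml raddf_sum/=; apply: eq_bigr => k _.
    rewrite !mxE /a /b; case: (P i k) => ? ?; case: (P i l) => ? ? /=; ring.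
  by rewrite -nP (le_trans (ler_normD _ _))// lerD.
pose e i : C := (d i +i* Num.sqrt (1 - d i ^+ 2))%C.
pose V := adjmx P *m diag_mx (\row_i e i) *m P.
have adjV : adjmx V = adjmx P *m diag_mx (\row_i (e i)^*%C) *m P.
  rewrite /V !adjmxM adjmxK adjmx_diag mulmxA; congr (_ *m diag_mx _ *m _).
  by apply/rowP => i; rewrite !mxE.
have ee i : e i * (e i)^*%C = 1.
  apply/eqP; rewrite eq_complex /= mulrN opprK -!expr2 sqr_sqrtr; last first.
    by rewrite subr_ge0 -real_normK ?num_real// expr_le1.
  by rewrite addrC subrK eqxx /= mulrC; apply/eqP; ring.
have ee' i : (e i)^*%C * e i = 1 by rewrite mulrC.
have diag1 (u v : 'I_n -> C) : (forall i, u i * v i = 1) ->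
    (adjmx P *m diag_mx (\row_i u i) *m P) *m
    (adjmx P *m diag_mx (\row_i v i) *m P) = 1%:M.
  move=> uv; rewrite !mulmxA -[_ *m P *m adjmx P]mulmxA PU mulmx1.
  rewrite -[_ *m diag_mx _ *m diag_mx _]mulmxA mulmx_diag.
  rewrite (_ : diag_mx _ = 1%:M) ?mulmx1//.
  by rewrite -diag_const_mx; congr diag_mx; apply/rowP => i; rewrite !mxE.
exists V; split.
- by rewrite /unitary adjV; exact: diag1.
- by rewrite /unitary adjmxK adjV; exact: diag1.
move=> k l; have : V + adjmx V = 2 *: A.
  rewrite adjV /V -mulmxDl -mulmxDr AE scalemxAl scalemxAr; congr (_ *m _ *m _).
  apply/matrixP => i j; rewrite !mxE; case: eqP => [->|_]; last first.
    by rewrite !mulr0n addr0 mulr0.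
  rewrite !mulr1n spE; apply/eqP; rewrite eq_complex/=; apply/andP; split; apply/eqP; ring.
move=> /matrixP/(_ k l)/(congr1 (@complex.Re R)).
rewrite mxE raddfD/= => ->; rewrite !mxE/=; ring.
Qed.

Lemma Re_entry_le_opnorm k (A : 'M[C]_k) (a b : 'I_k) :
  ((complex.Re (A a b))%:E <= opnorm A)%E.
Proof.
pose e : 'cV[C]_k := delta_mx b 0.
apply: le_trans (_ : (cvnorm (A *m e))%:E <= _)%E; last first.
  apply: ereal_sup_ubound; exists e => //=.
  rewrite /cvnorm (bigD1 b)//= big1 => [|j jb]; last first.
    by rewrite mxE (negbTE jb) /= expr0n/= addr0.
  by rewrite mxE !eqxx/= expr0n/= expr1n !addr0 sqrtr1.
rewrite lee_fin /cvnorm /e -colE; apply: le_trans (ler_norm _) _.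
rewrite -sqrtr_sqr ler_wsqrtr// (bigD1 a)//= mxE -addrA lerDl.
by rewrite addr_ge0 ?sqr_ge0// sumr_ge0// => j _; rewrite addr_ge0 ?sqr_ge0.
Qed.

Lemma unitary_tperm_mx n (a b : 'I_n) : unitary (tperm_mx a b : 'M[C]_n).
Proof.
rewrite /unitary /adjmx /tperm_mx map_perm_mx tr_perm_mx -perm_mxM.
by rewrite mulgV perm_mx1.
Qed.

(* The test vectors are both [e_0]: the outer unitaries are the transpositions
   [(0 i)], which move [e_0] to [e_i], so the middle one contributes the entry
   [V (i 1) (i 0) (i 2)]. *)
Lemma tensor_cbnorm_ge_unitary n (T : tensor R n.+1 3) (V : 'I_n.+1 -> 'M[C]_n.+1) :
  (forall j, unitary (V j)) ->
  ((\sum_i T i * complex.Re (V (i 1) (i ord0) (i ord_max)))%:E <= tensor_cbnorm T)%E.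
Proof.
move=> VU.
pose U (j : 'I_3) (a : 'I_n.+1) : 'M[C]_n.+1 :=
  if j == 1 then V a else tperm_mx 0 a.
apply: le_trans (_ : opnorm (tensor_eval T U) <= _)%E; last first.
  apply: ereal_sup_ubound; exists n, U; split=> // j a.
  by rewrite /U; case: eqP => _; [exact: VU|exact: unitary_tperm_mx].
apply: le_trans (Re_entry_le_opnorm _ _ 0 0).
rewrite lee_fin le_eqVlt; apply/orP; left; apply/eqP.
rewrite /tensor_eval summxE raddf_sum/=; apply: eq_bigr => i _.
rewrite mxE !big_ord_recl big_ord0 mulr1.
have -> : lift ord0 ord0 = 1 :> 'I_3 by apply/val_inj.
have -> : lift ord0 (lift ord0 ord0) = ord_max :> 'I_3 by apply/val_inj.
rewrite /U/=.
have -> : (tperm_mx 0 (i ord0) * (V (i 1) * tperm_mx 0 (i ord_max))) 0 0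
    = V (i 1) (i ord0) (i ord_max).
  by rewrite -[_ * _]row_permE mxE tpermL -[_ * _]/(_ *m _) -[tperm_mx _ _]/(perm_mx _)
    -[tperm _ _]invgK -col_permE mxE tpermV tpermL.
by case: (V _ _ _) => x y /=; rewrite mul0r subr0.
Qed.

(** The pairing is linear in the middle factor, so replacing every [W j] by the average of [V j] and
    its adjoint makes it the average of just two unitary evaluations: all [V j], or all adjoints.
    The larger one is at least the average. *)
Lemma tensor_cbnorm_ge n (T : tensor R n.+1 3) (W : 'I_n.+1 -> 'M[R]_n.+1) :
  (forall j, (W j)^T = W j) ->
  (forall j (x : 'I_n.+1 -> R),
    `|\sum_k \sum_l x k * W j k l * x l| <= \sum_k x k ^+ 2) ->
  ((\sum_i T i * W (i 1) (i ord0) (i ord_max))%:E <= tensor_cbnorm T)%E.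
Proof.
move=> Wsym Wcontr.
have /choice[V VP] := fun j => real_contraction_unitary_average _ _ (Wsym j) (Wcontr j).
pose s (V : 'I_n.+1 -> 'M[C]_n.+1) :=
  \sum_i T i * complex.Re (V (i 1) (i ord0) (i ord_max)).
have h1 : ((s V)%:E <= tensor_cbnorm T)%E.
  by apply: tensor_cbnorm_ge_unitary => j; have [] := VP j.
have h2 : ((s (fun j => adjmx (V j)))%:E <= tensor_cbnorm T)%E.
  by apply: tensor_cbnorm_ge_unitary => j; have [] := VP j.
have : 2 * (\sum_i T i * W (i 1) (i ord0) (i ord_max)) = s V + s (fun j => adjmx (V j)).
  rewrite /s -big_split/= mulr_sumr; apply: eq_bigr => i _.
  by rewrite mulrCA -mulrDr; have [_ _ ->] := VP (i 1).
move=> h; have [le|lt] := lerP (s V) (s (fun j => adjmx (V j))).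
  by apply: le_trans h2; rewrite lee_fin; lra.
by apply: le_trans h1; rewrite lee_fin; lra.
Qed.

Lemma form_cbnorm_ge n (coef : {ffun 'I_n.+1 -> nat} -> R)
    (W : 'I_n.+1 -> 'M[R]_n.+1) (S : tensor R n.+1 3) :
  (forall j, (W j)^T = W j) ->
  (forall j (x : 'I_n.+1 -> R),
    `|\sum_k \sum_l x k * W j k l * x l| <= \sum_k x k ^+ 2) ->
  (forall i : {ffun 'I_3 -> 'I_n.+1}, W (i 1) (i ord0) (i ord_max) = S i) ->
  (forall s i, tcomp S s i = S i) ->
  ((\sum_i @form_tensor R n.+1 3 coef i * S i)%:E <= @form_cbnorm R n.+1 3 coef)%E.
Proof.
move=> Wsym Wcontr WS Ssym; apply: le_ereal_inf_tmp => _ [Ts [TE ->]].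
have -> : \sum_i @form_tensor R n.+1 3 coef i * S i = \sum_(s : {perm 'I_3}) \sum_i Ts s i * S i.
  under eq_bigr do rewrite TE mulr_suml.
  rewrite exchange_big; apply: eq_bigr => s _ /=.
  (* Substituting [i] composed with [s] for [i] moves the permutation from [Ts s] onto [S], which
     absorbs it by symmetry. *)
  pose h (t : {perm 'I_3}) (i : {ffun 'I_3 -> 'I_n.+1}) := [ffun u => i (t u)].
  have hK t : cancel (h t) (h t^-1%g).
    by move=> i; apply/ffunP => u; rewrite !ffunE permKV.
  rewrite [RHS](reindex (h s)); last first.
    by exists (h s^-1%g) => i _; [exact: hK|rewrite -{1}[s]invgK; exact: hK].
  by apply: eq_bigr => i _; rewrite -[X in _ = _ * X]/(tcomp S s i) Ssym.
rewrite -sumEFin; apply: lee_sum => s _.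
apply: le_trans (tensor_cbnorm_ge _ (Ts s) W Wsym Wcontr).
by rewrite lee_fin; apply: ler_sum => i _; rewrite WS.
Qed.

End CbLowerBound.

(** * Multi-indices of cubic forms *)

(** Cauchy-Schwarz against the constant 1: the double sum of [(u i - u j)^2] is twice the difference
    of the two sides. *)
Lemma sqr_sum_le_card (R : realType) (I : finType) (P : pred I) (u : I -> R) :
  (\sum_(i | P i) u i) ^+ 2 <= #|P|%:R * \sum_(i | P i) u i ^+ 2.
Proof.
have : 0 <= \sum_(i | P i) \sum_(j | P j) (u i - u j) ^+ 2.
  by apply: sumr_ge0 => i _; apply: sumr_ge0 => j _; exact: sqr_ge0.
have -> : \sum_(i | P i) \sum_(j | P j) (u i - u j) ^+ 2 =
    2 * (#|P|%:R * \sum_(i | P i) u i ^+ 2 - (\sum_(i | P i) u i) ^+ 2).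
  transitivity (\sum_(i | P i) \sum_(j | P j) (u i ^+ 2 + u j ^+ 2 - 2 * (u i * u j))).
    by apply: eq_bigr => i _; apply: eq_bigr => j _; ring.
  under eq_bigr do rewrite sumrB big_split/= sumr_const -[_ *+ _]mulr_natl -!mulr_sumr.
  rewrite sumrB big_split/= sumr_const -[X in _ + X - _]mulr_natl -!mulr_sumr -mulr_suml; ring.
lra.
Qed.

(** Cauchy-Schwarz on each fibre of [f]. It serves to control the coefficients of the signs in a
    slice, where several index pairs share one monomial. *)
Lemma sum_sqr_fiber_le (R : realType) (I A : finType) (f : I -> A) (u : I -> R) (q : nat) :
  (forall i, #|[set i' | f i' == f i]| <= q)%N ->
  \sum_a (\sum_(i | f i == a) u i) ^+ 2 <= q%:R * \sum_i u i ^+ 2.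
Proof.
move=> fq; rewrite (partition_big f xpredT)//= mulr_sumr; apply: ler_sum => a _.
apply: le_trans (sqr_sum_le_card _ _ _ _) _.
rewrite ler_wpM2r ?sumr_ge0// => [i _|]; first exact: sqr_ge0.
(* The hypothesis speaks only of fibres through a point of [I]; an empty fibre has cardinal 0. *)
have [i /eqP <-|h] := pickP (fun i => f i == a).
  by rewrite ler_nat; apply: leq_trans (fq i); rewrite cardsE.
by rewrite (eq_card0 h) ler_nat.
Qed.

Section MultiIndex.
Context (n : nat).
Implicit Type i : {ffun 'I_3 -> 'I_n}.

Lemma multidx_perm i (s : {perm 'I_3}) : multidx [ffun t => i (s t)] = multidx i.
Proof.
apply/ffunP => a; rewrite !ffunE -[RHS](card_preimset _ (@perm_inj _ s)).
by apply: eq_card => t; rewrite !inE ffunE.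
Qed.

Lemma tau_perm i (s : {perm 'I_3}) : tau [ffun t => i (s t)] = tau i.
Proof.
rewrite /tau; congr #|pred_of_set _|; apply/setP => k; apply/imsetP/imsetP => -[t _ ->].
  by exists (t * s)%g => //; apply/ffunP => u; rewrite !ffunE permM.
by exists (t * s^-1)%g => //; apply/ffunP => u; rewrite !ffunE permM permKV.
Qed.

Lemma tau_gt0 i : (0 < tau i)%N.
Proof.
rewrite card_gt0; apply/set0Pn; exists [ffun t => i ((1%g : {perm 'I_3}) t)].
by apply/imsetP; exists 1%g.
Qed.

Lemma tau_le6 i : (tau i <= 6)%N.
Proof. by apply: leq_trans (leq_imset_card _ _) _; rewrite card_Sn. Qed.

Lemma multidx_lt4 i a : (multidx i a < 4)%N.
Proof. by rewrite ffunE ltnS (leq_trans (max_card _))// card_ord. Qed.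

Lemma sum_multidx i : (\sum_a multidx i a = 3)%N.
Proof.
under eq_bigr do rewrite ffunE -sum1dep_card.
rewrite -[RHS](card_ord 3) -sum1_card (partition_big i xpredT)//.
Qed.

Lemma mon3_of_triple_subproof i :
  \sum_(a < n) (([ffun a => inord (multidx i a)] : {ffun 'I_n -> 'I_4}) a : nat) == 3%N.
Proof.
apply/eqP; rewrite -[RHS](sum_multidx i); apply: eq_bigr => a _.
by rewrite ffunE inordK ?multidx_lt4.
Qed.

Definition mon3_of_triple i : mon3 n :=
  exist _ [ffun a => inord (multidx i a)] (mon3_of_triple_subproof i).

Lemma mon3_of_tripleE i : mon3_nat (mon3_of_triple i) = multidx i.
Proof. by apply/ffunP => a; rewrite ffunE/= ffunE inordK ?multidx_lt4. Qed.

Lemma mon3_nat_inj : injective (@mon3_nat n).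
Proof.
move=> a b ab; apply/val_inj/ffunP => j; apply/val_inj.
by have /ffunP/(_ j) := ab; rewrite !ffunE.
Qed.

(** The middle position names the slice, the outer two its row and column. *)
Definition triple (k j l : 'I_n) : {ffun 'I_3 -> 'I_n} :=
  [ffun t => if t == ord0 then k else if t == 1 then j else l].

Lemma tripleE i : triple (i ord0) (i 1) (i ord_max) = i.
Proof.
apply/ffunP => t; rewrite ffunE; case: eqP => [->//|t0]; case: eqP => [->//|t1].
congr (i _); apply/val_inj; case: t t0 t1 => -[|[|[|//]]] t3 t0 t1 //=.
- by case: t0; apply/val_inj.
- by case: t1; apply/val_inj.
Qed.

(** Transposing a slice swaps the outer positions, so symmetry of the form tensor will make the
    slices symmetric matrices. *)
Lemma triple_swap k j l :
  [ffun t => triple k j l (tperm ord0 ord_max t)] = triple l j k.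
Proof.
by apply/ffunP => t; rewrite !ffunE permE /=; case: t => -[|[|[|]]].
Qed.

Lemma multidx_mem i i' t : multidx i = multidx i' -> exists t', i' t' = i t.
Proof.
move=> /ffunP/(_ (i t)); rewrite !ffunE => e.
have : (0 < #|[set t' | i' t' == i t]|)%N.
  by rewrite -e card_gt0; apply/set0Pn; exists t; rewrite inE.
by rewrite card_gt0 => /set0Pn[t']; rewrite inE => /eqP; exists t'.
Qed.

(** Equal monomials have the same variables, so both entries of [q] lie in the set of [p.1], [j],
    [p.2]: at most 3 choices for each. *)
Lemma card_triple_fiber j (p : 'I_n * 'I_n) :
  (#|[set q : 'I_n * 'I_n | mon3_of_triple (triple q.1 j q.2)
       == mon3_of_triple (triple p.1 j p.2)]| <= 9)%N.
Proof.
pose S : {set 'I_n} := [set p.1; j; p.2].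
have S3 : (#|S| <= 3)%N.
  rewrite /S (leq_trans (leq_card_setU _ _))// cards1 -[3%N]/(2 + 1)%N leq_add2r.
  by rewrite cards2; case: eqP.
apply: (@leq_trans #|finset.setX S S|); last by rewrite cardsX (@leq_mul _ _ 3 3).
apply/subset_leq_card/fintype.subsetP => q; rewrite inE => /eqP/(congr1 (@mon3_nat n)).
rewrite !mon3_of_tripleE => e.
have memS t : triple p.1 j p.2 t \in S.
  by rewrite ffunE !inE; case: ifP => _; [|case: ifP => _]; rewrite eqxx ?orbT.
rewrite inE; apply/andP; split.
  have [t] := multidx_mem _ _ ord0 e.
  by rewrite [X in _ = X]ffunE/= => <-.
have [t] := multidx_mem _ _ ord_max e.
by rewrite [X in _ = X]ffunE/= => <-.
Qed.

End MultiIndex.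

(** Stars and bars: there are at most ['C(n + 3, 3)] exponent vectors. Times 3! this is
    [(n + 3)(n + 2)(n + 1)], and [n + 3 <= 3 (n + 1)], [n + 2 <= 2 (n + 1)]. *)
Lemma card_mon3 n : (#|{: mon3 n.+1}| <= n.+1 ^ 3)%N.
Proof.
rewrite card_sig.
pose f (a : {ffun 'I_n.+1 -> 'I_4}) := [tuple a j | j < n.+1].
have f_inj : injective f.
  by move=> a b ab; apply/ffunP => j; rewrite -(tnth_mktuple a) -/(f a) ab tnth_mktuple.
rewrite -(card_imset _ f_inj).
apply: (@leq_trans 'C(n + 3, n)).
  rewrite -card_ord_partitions; apply/subset_leq_card/fintype.subsetP => _ /imsetP[a a3 ->].
  rewrite inE big_tuple; move: a3; rewrite !inE => /eqP a3; apply/eqP.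
  by rewrite -[RHS]a3; apply: eq_bigr => j _; rewrite tnth_mktuple.
rewrite -[leqLHS]bin_sub ?leq_addr// addKn.
rewrite -(@leq_pmul2r 3`!)// bin_ffact !factS fact0 !ffactnS ffactn0 addn3/=.
apply: (@leq_trans (n.+1 * 3 * ((n.+1 * 2) * (n.+1 * 1)))).
  by apply: leq_mul; [lia|apply: leq_mul; lia].
by rewrite !expnS expn0; nia.
Qed.

Lemma cubic_coefE (R : realType) n (eps : {ffun mon3 n -> bool}) i :
  cubic_coef R eps (multidx i) = sgn R (eps (mon3_of_triple _ i)).
Proof.
rewrite /cubic_coef -mon3_of_tripleE; case: pickP => [a /eqP/mon3_nat_inj->//|].
by move=> /(_ (mon3_of_triple _ i)); rewrite eqxx.
Qed.

Section FormTensor.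
Context (R : realType) (n : nat) (eps : {ffun mon3 n -> bool}).
Local Notation T := (@form_tensor R n 3 (cubic_coef R eps)).

Lemma form_tensor_cubicE i : T i = sgn R (eps (mon3_of_triple _ i)) / (tau i)%:R.
Proof. by rewrite /form_tensor cubic_coefE. Qed.

Lemma form_tensor_perm s i : tcomp T s i = T i.
Proof. by rewrite /tcomp /form_tensor multidx_perm tau_perm. Qed.

Lemma form_tensor_sqr_ge i : 1 / 36 <= T i ^+ 2.
Proof.
rewrite form_tensor_cubicE exprMn exprVn sgn_sqr !div1r lef_pV2 ?posrE ?exprn_gt0 ?ltr0n ?tau_gt0//.
by rewrite -natrX ler_nat (@leq_exp2r _ 6 2) ?tau_le6.
Qed.

End FormTensor.

(** * Random cubic forms *)

Section RandomCubic.
Context (R : realType) (n : nat).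
Local Notation N := (n.+1).
Local Notation Eps := {ffun mon3 N -> bool}.
Implicit Types (eps : Eps) (x y : 'I_N -> R).

Definition slice eps (j : 'I_N) : 'M[R]_N :=
  \matrix_(k, l) form_tensor (cubic_coef R eps) (triple _ k j l).

(** The total coefficient of the sign [eps a] in the bilinear form of slice [j]; grouping by
    monomial is what leaves a sum over independent signs. *)
Definition slice_coef j x y (a : mon3 N) : R :=
  \sum_(p : 'I_N * 'I_N | mon3_of_triple _ (triple _ p.1 j p.2) == a)
    x p.1 * y p.2 / (tau (triple _ p.1 j p.2))%:R.

Lemma bil_sliceE eps j x y :
  bil R N (slice eps j) x y = \sum_a sgn R (eps a) * slice_coef j x y a.
Proof.
rewrite /bil pair_big/= (partition_big
  (fun p : 'I_N * 'I_N => mon3_of_triple _ (triple _ p.1 j p.2)) xpredT)//=.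
apply: eq_bigr => a _; rewrite mulr_sumr; apply: eq_bigr => p /eqP <-.
by rewrite mxE form_tensor_cubicE; ring.
Qed.

(** The 9 is the fibre bound; what remains is at most [sqn x * sqn y], since [tau] is at least 1. *)
Lemma sum_slice_coef_sqr j x y : sqn R N x <= 1 -> sqn R N y <= 1 ->
  \sum_a slice_coef j x y a ^+ 2 <= 9.
Proof.
move=> x1 y1; apply: le_trans (sum_sqr_fiber_le _ _ _ _ _ _ (@card_triple_fiber _ j)) _.
rewrite -[leRHS]mulr1 ler_wpM2l//.
apply: (@le_trans _ _ (sqn R N x * sqn R N y)); last by rewrite mulr_ile1 ?sqn_ge0.
rewrite /sqn big_distrlr/= pair_big/=; apply: ler_sum => p _.
rewrite !exprMn -[leRHS]mulr1 ler_wpM2l ?(mulr_ge0 (sqr_ge0 _) (sqr_ge0 _))//.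
have t0 := tau_gt0 _ (triple _ p.1 j p.2).
by rewrite exprVn invf_le1 ?exprn_gt0 ?ltr0n// exprn_ege1// ler1n.
Qed.

Lemma pow2_le_expR m : (2 : R) ^+ m <= expR m%:R.
Proof.
rewrite -[m%:R]mulr1 expRM_natl lerXn2r// ?nnegrE ?expR_ge0//.
by have := expR_ge1Dx (1 : R).
Qed.

Lemma uprob_slice_form j x y : sqn R N x <= 1 -> sqn R N y <= 1 ->
  uprob R _ [set eps : Eps | 60 * Num.sqrt N%:R < `|bil R N (slice eps j) x y|]
    <= 2 * expR (- (50 * N%:R)).
Proof.
move=> x1 y1; under eq_finset do rewrite bil_sliceE.
apply: le_trans (rademacher_tail _ _ _ 9 _ _ _ (sum_slice_coef_sqr j x y x1 y1)) _ => //.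
(* The exponent is [(60 sqrt N)^2 / (8 * 9) = 50 N]. *)
rewrite exprMn sqr_sqrtr// ler_wpM2l// ler_expR; lra.
Qed.

(* The net has at most [2^(18n) <= e^(18n)] points, so the union over pairs of net
   points costs [e^(36n)] against the tail [2 e^(-50n)]. *)
Definition slices_bad : {set Eps} :=
  \bigcup_(j : 'I_N) \bigcup_(g | net N g) \bigcup_(h | net N h)
    [set eps : Eps | 60 * Num.sqrt N%:R
       < `|bil R N (slice eps j) (gridv R N g) (gridv R N h)|].

Lemma uprob_slices_bad : uprob R _ slices_bad <= N%:R * (2 * expR (- N%:R)).
Proof.
pose b : R := 2 * expR (- (50 * N%:R)).
apply: (@le_trans _ _ (N%:R * (#|net N|%:R * (#|net N|%:R * b)))).
  rewrite -[X in X%:R * _](card_ord N); apply: uprob_bigcup => j _.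
  apply: uprob_bigcup => g gn; apply: uprob_bigcup => h hn.
  by apply: uprob_slice_form; apply: net_sqn_le1.
rewrite ler_wpM2l// mulrA.
have cn : #|net N|%:R <= expR (18 * N%:R) :> R.
  by apply: le_trans (card_net R N) _; rewrite -natrM pow2_le_expR.
have b0 : 0 <= b by rewrite mulr_ge0// expR_ge0.
apply: (@le_trans _ _ (expR (18 * N%:R) * expR (18 * N%:R) * b)).
  by rewrite ler_wpM2r// ler_pM.
rewrite /b mulrCA -!expRD ler_wpM2l// ler_expR.
have : 0 <= N%:R :> R by []. lra.
Qed.

Lemma slice_contraction eps j : eps \notin slices_bad ->
  forall x, `|bil R N (slice eps j) x x| <= 120 * Num.sqrt N%:R * sqn R N x.
Proof.
(* The passage from the net to the whole ball doubles the threshold 60. *)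
move=> ok; rewrite -[120%:R]/((2 * 60)%:R) natrM -mulrA.
apply: bil_le_of_net => // g h gn hn; rewrite leNgt; apply: contra ok => bad.
apply/bigcupP; exists j => //; apply/bigcupP; exists g => //.
by apply/bigcupP; exists h => //; rewrite inE.
Qed.

Definition sup_bad : {set Eps} :=
  \bigcup_(x : {ffun 'I_N -> bool})
    [set eps : Eps | 4 * N%:R ^+ 2 < `|cubic_eval eps (fun j => sgn R (x j))|].

(** At a vertex all monomials are 1 or -1, so the variance proxy is at most [N^3] and the tail
    exponent is [(4 N^2)^2 / (8 N^3) = 2 N]. The union over [2^N] vertices costs at most
    [expR N]. *)
Lemma uprob_sup_bad : uprob R _ sup_bad <= 2 * expR (- N%:R).
Proof.
apply: (@le_trans _ _ (#|{ffun 'I_N -> bool}|%:R * (2 * expR (- (2 * N%:R))))).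
  apply: uprob_bigcup => x _.
  pose c (a : mon3 N) : R := \prod_(j < N) sgn R (x j) ^+ (sval a j).
  have c1 : \sum_a c a ^+ 2 <= N%:R ^+ 3.
    apply: (@le_trans _ _ (\sum_(a : mon3 N) 1)).
      apply: ler_sum => a _; rewrite -prodrXl big1// => j _.
      by rewrite exprAC sgn_sqr expr1n.
    by rewrite sumr_const -natrX ler_nat card_mon3.
  apply: le_trans (rademacher_tail _ _ c _ _ _ _ c1) _.
  - by rewrite exprn_gt0.
  - by rewrite mulr_ge0// exprn_ge0.
  rewrite ler_wpM2l// ler_expR lerN2 le_eqVlt; apply/orP; left; apply/eqP.
  by field; rewrite nat1r pnatr_eq0.
rewrite card_ffun card_bool card_ord natrX mulrCA ler_wpM2l//.
apply: (@le_trans _ _ (expR N%:R * expR (- (2 * N%:R)))).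
  by rewrite ler_wpM2r ?expR_ge0// pow2_le_expR.
rewrite -expRD ler_expR; lra.
Qed.

Lemma cube_supnorm_le eps : eps \notin sup_bad ->
  cube_supnorm R eps <= 4 * N%:R ^+ 2.
Proof.
move=> ok; rewrite /cube_supnorm; elim/big_ind: _ => //.
  by move=> a b ha hb; rewrite ge_max ha.
move=> x _; rewrite leNgt; apply: contra ok => bad.
by apply/bigcupP; exists x => //; rewrite inE.
Qed.

Lemma form_cbnorm_ge_good eps : eps \notin slices_bad ->
  ((N%:R ^+ 3 / ((120 * 36) * Num.sqrt N%:R))%:E <= @form_cbnorm R N 3 (cubic_coef R eps))%E.
Proof.
move=> ok; pose q : R := 120 * Num.sqrt N%:R.
have q0 : 0 < q by rewrite mulr_gt0// sqrtr_gt0.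
pose T := @form_tensor R N 3 (cubic_coef R eps).
apply: le_trans (form_cbnorm_ge _ _ _ (fun j => q^-1 *: slice eps j)
  (fun i => q^-1 * T i) _ _ _ _).
(* The pairing is [q^-1] times a sum of [N^3] squares, each at least 1/36. *)
- rewrite lee_fin.
  have -> : N%:R ^+ 3 / ((120 * 36) * Num.sqrt N%:R)
      = \sum_(i : {ffun 'I_3 -> 'I_N}) q^-1 * (1 / 36) :> R.
    rewrite sumr_const card_ffun !card_ord -[RHS]mulr_natr natrX /q; field.
    by rewrite sqrtr_eq0 -ltNge.
  apply: ler_sum => i _; rewrite [leRHS]mulrCA ler_wpM2l ?invr_ge0 ?(ltW q0)// -expr2.
  exact: form_tensor_sqr_ge.
- move=> j; apply/matrixP => k l; rewrite !mxE -(triple_swap _ k j l).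
  by congr (_ * _); exact: form_tensor_perm.
- move=> j x; have -> : \sum_k \sum_l x k * (q^-1 *: slice eps j) k l * x l
      = q^-1 * bil R N (slice eps j) x x.
    rewrite /bil mulr_sumr; apply: eq_bigr => k _; rewrite mulr_sumr.
    by apply: eq_bigr => l _; rewrite mxE; ring.
  rewrite normrM gtr0_norm ?invr_gt0// mulrC ler_pdivrMr// mulrC.
  exact: slice_contraction.
- by move=> i; rewrite !mxE tripleE.
- by move=> s i; rewrite /tcomp; congr (_ * _); exact: form_tensor_perm.
Qed.

End RandomCubic.

(** * Choice of the constants and final union bound *)

Theorem theorem4p1 (R : realType) :
  exists C c : R, 0 < C /\ 0 < c /\
  forall n : nat, (0 < n)%N ->
    1 - C * n%:R * expR (- (c * n%:R)) <=
      #|[set eps : {ffun mon3 n -> bool} |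
          ((c * Num.sqrt n%:R * @cube_supnorm R n eps)%:E
             <= @form_cbnorm R n 3 (@cubic_coef R n eps))%E]|%:R
      / #|{: {ffun mon3 n -> bool}}|%:R.
Proof.
(* This [c] makes [c sqrt N] times the bound [4 N^2] on the cube norm equal to the lower bound
   [N^3 / (120 * 36 sqrt N)]. *)
have [c [c0 cE]] : exists c : R, 0 < c /\ c * (4 * (120 * 36)) = 1.
  exists (4 * (120 * 36))^-1; split; first by rewrite invr_gt0 !mulr_gt0 ?ltr0n.
  by rewrite mulVf// !mulf_neq0 ?pnatr_eq0.
have c1 : c <= 1 by lra.
(* The failure probability is at most [(2 N + 2) expR (- N)], and [2 N + 2 <= 4 N]; [c <= 1] then
   weakens the exponent to [- c N]. *)
exists 4, c; do 2!split=> //; case=> // n _; set E := [set eps | _].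
pose B := slices_bad R n :|: sup_bad R n.
have BE : ~: B \subset E.
  apply/fintype.subsetP => eps; rewrite !inE negb_or => /andP[ok1 ok2].
  apply: le_trans (form_cbnorm_ge_good _ _ _ ok1); rewrite lee_fin.
  have s0 : 0 < Num.sqrt n.+1%:R :> R by rewrite sqrtr_gt0.
  apply: (@le_trans _ _ (c * Num.sqrt n.+1%:R * (4 * n.+1%:R ^+ 2))).
    by rewrite ler_wpM2l ?cube_supnorm_le// mulr_ge0// ?(ltW c0) ?(ltW s0).
  have s2 : Num.sqrt n.+1%:R ^+ 2 = n.+1%:R :> R by rewrite sqr_sqrtr.
  rewrite ler_pdivlMr; last by rewrite !mulr_gt0 ?ltr0n.
  have -> : c * Num.sqrt n.+1%:R * (4 * n.+1%:R ^+ 2) * ((120 * 36) * Num.sqrt n.+1%:R)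
      = c * (4 * (120 * 36)) * (Num.sqrt n.+1%:R ^+ 2 * n.+1%:R ^+ 2) by ring.
  by rewrite cE s2 mul1r -exprS.
apply: le_trans (uprob_sub R _ _ _ BE).
rewrite uprobC; last by rewrite card_ffun card_bool expn_gt0.
rewrite lerD2l lerN2; apply: le_trans (uprobU _ _ _ _) _.
apply: le_trans (lerD (uprob_slices_bad R n) (uprob_sup_bad R n)) _.
have e1 : expR (- n.+1%:R) <= expR (- (c * n.+1%:R)) :> R.
  by rewrite ler_expR lerN2 ler_piMl.
have e0 := expR_ge0 (- n.+1%:R : R).
have n1 : 1 <= n.+1%:R :> R by rewrite ler1n.
apply: (@le_trans _ _ (4 * n.+1%:R * expR (- n.+1%:R))); last first.
  by rewrite ler_wpM2l// mulr_ge0.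
have : 0 <= (n.+1%:R - 1) * expR (- n.+1%:R) :> R by rewrite mulr_ge0// subr_ge0.
lra.
Qed.
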